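(* Let $H$ be a complex Hilbert space of finite dimension $D\ge1$ and let $\mathcal O=(\mu_{O},\eta_{O},\delta_{O},\epsilon_{O})$, $\mathcal O'=(\mu_{O'},\eta_{O'},\delta_{O'},\epsilon_{O'})$ be a strongly complementary pair of $\dagger$-special commutative Frobenius algebras on $H$. Let $S:H\to H$ be the map $$S=(\epsilon_O\mu_O\otimes 1_H)\circ(1_H\otimes\delta_{O'}\eta_{O'}).$$ Then the pair forms a scaled Hopf algebra with antipode $S$: $$D\cdot\mu_O\circ(S\otimes1_H)\circ\delta_{O'}=\eta_O\circ\epsilon_{O'}.$$
   Context: A commutative Frobenius algebra on $H$ consists of linear maps $\mu:H\otimes H\to H$, $\eta:\mathbb C\to H$, $\delta:H\to H\otimes H$, $\epsilon:H\to\mathbb C$ such that $(\mu,\eta)$ is a commutative monoid, $(\delta,\epsilon)$ is a cocommutative comonoid and $(1\otimes\mu)(\delta\otimes1)=\delta\mu=(\mu\otimes1)(1\otimes\delta)$. It is $\dagger$-special ($\dagger$-SCFA) if $\mu=\delta^\dagger$, $\eta=\epsilon^\dagger$ and $\mu\delta=1_H$. Two $\dagger$-SCFAs $\mathcal O,\mathcal O'$ on the $D$-dimensional space $H$ are strongly complementary if $(\mu_O,\eta_O,\delta_{O'},\epsilon_{O'})$ is a bialgebra up to scalar factors (scaled bialgebra equations), i.e. with $\sigma$ the swap on $H\otimes H$: $$\delta_{O'}\mu_O=\sqrt D\,(\mu_O\otimes\mu_O)(1\otimes\sigma\otimes1)(\delta_{O'}\otimes\delta_{O'}),\quad \sqrt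 D\,\delta_{O'}\eta_O=\eta_O\otimes\eta_O,\quad \sqrt D\,\epsilon_{O'}\mu_O=\epsilon_{O'}\otimes\epsilon_{O'} .$$ (Taking adjoints, this condition is symmetric in $\mathcal O$ and $\mathcal O'$.) *)

(* Defs.v *)
From HB Require Import structures.
From mathcomp Require Import all_boot all_order all_algebra.
From mathcomp Require Import sesquilinear complex reals.

Set Implicit Arguments.
Unset Strict Implicit.
Unset Printing Implicit Defensive.

Import Order.TTheory GRing.Theory Num.Theory Num.Def.
Local Open Scope ring_scope.

(* Tensor products of finite-dimensional vector spaces. An element of U (x) V
   is stored as the matrix of its coordinates on the tensors e_i (x) f_j, where
   e and f are the bases of U and V chosen by the library. The lemmas tliftE
   and tens_span show that this is a tensor product: bilinear maps factor
   through tprod, and pure tensors span. All maps below are obtained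
   by tlift from their values on pure tensors. *)

Section Tensor.
Variable K : fieldType.
Implicit Types U V W X : vectType K.

Definition tens U V : vectType K := 'M[K]_(\dim {:U}, \dim {:V}).

Definition tprod U V (u : U) (v : V) : tens U V :=
  \matrix_(i, j) (coord (vbasis {:U}) i u * coord (vbasis {:V}) j v).

Definition tlift_fun U V W (b : U -> V -> W) (x : tens U V) : W :=
  \sum_i \sum_j x i j *: b (vbasis {:U})`_i (vbasis {:V})`_j.

Fact tlift_fun_linear U V W (b : U -> V -> W) : linear (tlift_fun b).
Proof.
move=> a x y; rewrite /tlift_fun scaler_sumr -big_split /=.
apply: eq_bigr => i _; rewrite scaler_sumr -big_split /=.
by apply: eq_bigr => j _; rewrite !mxE scalerDl scalerA.
Qed.

HB.instance Definition _ U V W (b : U -> V -> W) :=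
  GRing.isLinear.Build K (tens U V) W _ (tlift_fun b) (tlift_fun_linear b).

Definition tlift U V W (b : U -> V -> W) : 'Hom(tens U V, W) :=
  linfun (tlift_fun b).

Local Notation is_bilinear b := (bilinear_for *:%R *:%R b).

Lemma lin_vbasis U W (f : U -> W) (u : U) : linear f ->
  f u = \sum_i coord (vbasis {:U}) i u *: f (vbasis {:U})`_i.
Proof.
move=> fL; pose g := GRing.isLinear.Build K U W _ f fL.
pose F : {linear U -> W} := HB.pack f g.
rewrite -[f]/(F : U -> W) {1}(coord_vbasis (memvf u)) linear_sum.
by apply: eq_bigr => i _; rewrite linearZ.
Qed.

Lemma tliftE U V W (b : U -> V -> W) u v : is_bilinear b ->
  tlift b (tprod u v) = b u v.
Proof.
move=> [bl br]; rewrite lfunE /= /tlift_fun (lin_vbasis u (bl v)).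
apply: eq_bigr => i _; rewrite (lin_vbasis v (br _)) scaler_sumr.
by apply: eq_bigr => j _; rewrite mxE scalerA.
Qed.

Lemma tprod_bilinear U V : is_bilinear (@tprod U V).
Proof.
by split=> [v a x y|u a x y]; apply/matrixP=> i j;
   rewrite !mxE linearP /= ?mulrDl ?mulrDr ?mulrA // [_ * a]mulrC.
Qed.

Lemma tens_span U V (x : tens U V) :
  x = \sum_i \sum_j x i j *: tprod (vbasis {:U})`_i (vbasis {:V})`_j.
Proof.
have bf (T : vectType K) : free (vbasis {:T}) := basis_free (vbasisP _).
apply/matrixP=> k l; rewrite summxE (bigD1 k) //= summxE (bigD1 l) //=.
rewrite !mxE !coord_free // !eqxx !mulr1 big1 ?addr0 => [|j jl].
  rewrite big1 ?addr0 // => i ik; rewrite summxE big1 // => j _.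
  by rewrite !mxE !coord_free // (negPf ik) mul0r mulr0.
by rewrite !mxE !coord_free // (negPf jl) !mulr0.
Qed.

Lemma eq_tens U V W (f g : 'Hom(tens U V, W)) :
  (forall u v, f (tprod u v) = g (tprod u v)) -> f = g.
Proof.
move=> fg; apply/lfunP=> x; rewrite (tens_span x) !linear_sum.
apply: eq_bigr => i _; rewrite !linear_sum; apply: eq_bigr => j _.
by rewrite !linearZ /= fg.
Qed.

Definition tmap U V W X (f : 'Hom(U, W)) (g : 'Hom(V, X)) :
    'Hom(tens U V, tens W X) :=
  tlift (fun u v => tprod (f u) (g v)).

Definition tswap U V : 'Hom(tens U V, tens V U) :=
  tlift (fun u v => tprod v u).

Definition tassoc U V W : 'Hom(tens (tens U V) W, tens U (tens V W)) :=
  tlift (fun x w => tlift (fun u v => tprod u (tprod v w)) x).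

Definition tassocV U V W : 'Hom(tens U (tens V W), tens (tens U V) W) :=
  tlift (fun u x => tlift (fun v w => tprod (tprod u v) w) x).

Definition tlunit V : 'Hom(tens K^o V, V) := tlift (fun (c : K^o) v => c *: v).
Definition trunit V : 'Hom(tens V K^o, V) := tlift (fun v (c : K^o) => c *: v).
Definition tlunitV V : 'Hom(V, tens K^o V) := linfun (@tprod K^o V 1).
Definition trunitV V : 'Hom(V, tens V K^o) :=
  linfun (fun v => @tprod V K^o v 1).

(* 1 (x) swap (x) 1 *)
Definition tmidswap U V W X :
    'Hom(tens (tens U V) (tens W X), tens (tens U W) (tens V X)) :=
  (tassocV U W (tens V X)
   \o tmap \1 (tassoc W V X \o tmap (tswap V W) \1 \o tassocV V W X)
   \o tassoc U V (tens W X))%VF.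

Lemma tmapE U V W X (f : 'Hom(U, W)) (g : 'Hom(V, X)) u v :
  tmap f g (tprod u v) = tprod (f u) (g v).
Proof.
have [pl pr] := tprod_bilinear W X.
by rewrite tliftE //; split=> [y a x z|y a x z] /=;
  rewrite linearP /= ?pl ?pr.
Qed.

Lemma tswapE U V (u : U) (v : V) : tswap U V (tprod u v) = tprod v u.
Proof.
have [pl pr] := tprod_bilinear V U.
by rewrite tliftE //; split=> [y a x z|y a x z] /=; rewrite ?pl ?pr.
Qed.

Lemma tassocE U V W (u : U) (v : V) (w : W) :
  tassoc U V W (tprod (tprod u v) w) = tprod u (tprod v w).
Proof.
have [pl pr] := tprod_bilinear U (tens V W).
have [ql qr] := tprod_bilinear V W.
rewrite !tliftE //.
- by split=> [y a x z|y a x z] /=; rewrite ?pl ?ql ?pr.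
- split=> [y a x z|y a x z] /=; first by rewrite linearP.
  rewrite !lfunE /= /tlift_fun scaler_sumr -big_split /=.
  apply: eq_bigr => i _; rewrite scaler_sumr -big_split /=.
  by apply: eq_bigr => j _; rewrite qr pr scalerDr !scalerA mulrC.
Qed.

Lemma tassocVE U V W (u : U) (v : V) (w : W) :
  tassocV U V W (tprod u (tprod v w)) = tprod (tprod u v) w.
Proof.
have [pl pr] := tprod_bilinear (tens U V) W.
have [ql qr] := tprod_bilinear U V.
rewrite !tliftE //.
- by split=> [y a x z|y a x z] /=; rewrite ?qr ?pl ?pr.
- split=> [y a x z|y a x z] /=; last by rewrite linearP.
  rewrite !lfunE /= /tlift_fun scaler_sumr -big_split /=.
  apply: eq_bigr => i _; rewrite scaler_sumr -big_split /=.
  by apply: eq_bigr => j _; rewrite ql pl scalerDr !scalerA mulrC.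
Qed.

Lemma tlunitE V (c : K^o) (v : V) : tlunit V (tprod c v) = c *: v.
Proof.
rewrite tliftE //; split=> [y a x z|y a x z] /=.
  by rewrite scalerDl scalerA.
by rewrite scalerDr !scalerA mulrC.
Qed.

Lemma trunitE V (c : K^o) (v : V) : trunit V (tprod v c) = c *: v.
Proof.
rewrite tliftE //; split=> [y a x z|y a x z] /=.
  by rewrite scalerDr !scalerA mulrC.
by rewrite scalerDl scalerA.
Qed.

Lemma tlunitVE V (v : V) : tlunitV V v = @tprod K^o V 1 v.
Proof.
have L : linear (@tprod K^o V 1) := (tprod_bilinear K^o V).2 1.
pose F : {linear V -> tens K^o V} :=
  HB.pack (@tprod K^o V 1) (GRing.isLinear.Build K _ _ _ _ L).
exact: (lfunE F).
Qed.

Lemma trunitVE V (v : V) : trunitV V v = @tprod V K^o v 1.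
Proof.
have L : linear (fun v => @tprod V K^o v 1) := (tprod_bilinear V K^o).1 1.
pose F : {linear V -> tens V K^o} :=
  HB.pack (fun v => @tprod V K^o v 1) (GRing.isLinear.Build K _ _ _ _ L).
exact: (lfunE F).
Qed.

Lemma tmidswapE U V W X (u : U) (v : V) (w : W) (x : X) :
  tmidswap U V W X (tprod (tprod u v) (tprod w x)) =
  tprod (tprod u w) (tprod v x).
Proof.
rewrite /tmidswap !comp_lfunE tassocE tmapE !comp_lfunE tassocVE tmapE tswapE.
by rewrite !id_lfunE tassocE tassocVE.
Qed.

End Tensor.

Arguments tswap {K U V}.
Arguments tassoc {K U V W}.
Arguments tassocV {K U V W}.
Arguments tlunit {K V}.
Arguments trunit {K V}.
Arguments tlunitV {K V}.
Arguments trunitV {K V}.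
Arguments tmidswap {K U V W X}.

Notation "f \ox g" := (tmap f g) (at level 40, left associativity) : lfun_scope.

(* Inner products are linear in the first argument and conjugate-linear in the
   second, as in {dot H for conjC}. *)

Section Adjoint.
Variable C : numClosedFieldType.
Implicit Types U V : vectType C.

Definition cdot (a b : C^o) : C := a * b^*.

Definition tdot U V (dU : U -> U -> C) (dV : V -> V -> C)
    (x y : tens U V) : C :=
  \sum_i \sum_j \sum_k \sum_l x i j * (y k l)^* *
    (dU (vbasis {:U})`_i (vbasis {:U})`_k *
     dV (vbasis {:V})`_j (vbasis {:V})`_l).

Lemma dot_vbasis U (d : {dot U for conjC}) (u u' : U) :
  d u u' = \sum_i \sum_k coord (vbasis {:U}) i u *
    (coord (vbasis {:U}) k u')^* * d (vbasis {:U})`_i (vbasis {:U})`_k.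
Proof.
rewrite {1}(coord_vbasis (memvf u)) linear_sumlz; apply: eq_bigr => i _.
rewrite linearZl_LR /= {1}(coord_vbasis (memvf u')) linear_sumr mulr_sumr.
by apply: eq_bigr => k _; rewrite linearZr_LR /= mulrA.
Qed.

Lemma tdotE U V (dU : {dot U for conjC}) (dV : {dot V for conjC})
    (u u' : U) (v v' : V) :
  tdot dU dV (tprod u v) (tprod u' v') = dU u u' * dV v v'.
Proof.
rewrite [dU u u']dot_vbasis [dV v v']dot_vbasis /tdot mulr_suml.
apply: eq_bigr => i _; rewrite mulr_sumr; apply: eq_bigr => j _.
rewrite mulr_suml; apply: eq_bigr => k _; rewrite mulr_sumr.
apply: eq_bigr => l _; rewrite !mxE rmorphM /=.
by rewrite [RHS]mulrACA [X in _ = X * _]mulrACA.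
Qed.

(* g is the adjoint of f *)
Definition is_adjoint U V (dU : U -> U -> C) (dV : V -> V -> C)
    (f : 'Hom(U, V)) (g : 'Hom(V, U)) : Prop :=
  forall u v, dV (f u) v = dU u (g v).

End Adjoint.

Section Frobenius.
Variables (C : numClosedFieldType) (H : vectType C).

Record frob_ops := FrobOps {
  mu : 'Hom(tens H H, H);
  eta : 'Hom(C^o, H);
  delta : 'Hom(H, tens H H);
  eps : 'Hom(H, C^o)
}.

Local Open Scope lfun_scope.

Record is_comm_monoid (m : 'Hom(tens H H, H)) (e : 'Hom(C^o, H)) : Prop := {
  monoid_assoc : m \o (m \ox \1) = m \o (\1 \ox m) \o tassoc;
  monoid_unitl : m \o (e \ox \1) = tlunit;
  monoid_unitr : m \o (\1 \ox e) = trunit;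
  monoid_comm : m \o tswap = m
}.

Record is_cocomm_comonoid (d : 'Hom(H, tens H H)) (e : 'Hom(H, C^o)) :
    Prop := {
  comonoid_coassoc : tassoc \o (d \ox \1) \o d = (\1 \ox d) \o d;
  comonoid_counitl : tlunit \o (e \ox \1) \o d = \1;
  comonoid_counitr : trunit \o (\1 \ox e) \o d = \1;
  comonoid_cocomm : tswap \o d = d
}.

Record is_comm_frobenius (O : frob_ops) : Prop := {
  frob_monoid : is_comm_monoid (mu O) (eta O);
  frob_comonoid : is_cocomm_comonoid (delta O) (eps O);
  frob_left : (\1 \ox mu O) \o tassoc \o (delta O \ox \1) = delta O \o mu O;
  frob_right : (mu O \ox \1) \o tassocV \o (\1 \ox delta O) = delta O \o mu O
}.

Record is_dagger_SCFA (dot : {dot H for conjC}) (O : frob_ops) : Prop := {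
  scfa_frobenius : is_comm_frobenius O;
  scfa_mu : is_adjoint dot (tdot dot dot) (delta O) (mu O);
  scfa_eta : is_adjoint dot (@cdot C) (eps O) (eta O);
  scfa_special : mu O \o delta O = \1
}.

Record strongly_complementary (O O' : frob_ops) : Prop := {
  sc_bialg : delta O' \o mu O =
    sqrtC (\dim {:H})%:R *:
      ((mu O \ox mu O) \o tmidswap \o (delta O' \ox delta O'));
  sc_unit : sqrtC (\dim {:H})%:R *: (delta O' \o eta O) =
    (eta O \ox eta O) \o tlunitV;
  sc_counit : sqrtC (\dim {:H})%:R *: (eps O' \o mu O) =
    tlunit \o (eps O' \ox eps O')
}.

Definition antipode (O O' : frob_ops) : 'Hom(H, H) :=
  tlunit \o ((eps O \o mu O) \ox \1) \o tassocV
         \o (\1 \ox (delta O' \o eta O')) \o trunitV.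

End Frobenius.

(* Main.v *)
(** Let [A] be a dagger-SCFA and [phi = <-, h>] a functional with
    [c phi(xy) = phi(x) phi(y)], [c] real. Taking adjoints,
    [c (1 (x) phi) delta h = |h|^2 h], while the Frobenius law gives
    [c (1 (x) phi) delta x = phi(x) (1 (x) phi) delta eta]; hence
    [(1 (x) phi) delta eta = h] (trivially if [h = 0]). So [phi(x) = eps(x h)]
    and [c (1 (x) phi) delta x = phi(x) h]. Strong complementarity provides two such
    functionals with [c = sqrt D]: [eps_O] on [O'] and [eps_O'] on [O].
    Evaluating the bialgebra law at [x (x) eta_O'] and contracting one output
    with [eps_O] then gives [sqrt D] times the convolution
    [mu_O (S (x) 1) delta_O'] on one side, and [eps_O(x eta_O') eta_O / sqrt D = eps_O'(x) eta_O / sqrt D]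
    on the other. *)

From HB Require Import structures.
Require Import Defs.
From mathcomp Require Import all_boot all_order all_algebra.
From mathcomp Require Import sesquilinear complex reals.

Set Implicit Arguments.
Unset Strict Implicit.
Unset Printing Implicit Defensive.

Import Order.TTheory GRing.Theory Num.Theory Num.Def.
Local Open Scope ring_scope.

(** * Contractions of tensors and reduction to pure tensors *)

Section TensorMaps.
Variable K : fieldType.
Implicit Types U V W : vectType K.

Lemma tprodPl U V (v : V) a (x y : U) :
  tprod (a *: x + y) v = a *: tprod x v + tprod y v.
Proof. exact: (tprod_bilinear U V).1. Qed.

Lemma tprodPr U V (u : U) a (x y : V) :
  tprod u (a *: x + y) = a *: tprod u x + tprod u y.
Proof. exact: (tprod_bilinear U V).2. Qed.

Lemma tprodZl U V (v : V) a (x : U) : tprod (a *: x) v = a *: tprod x v.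
Proof. by apply/matrixP => i j; rewrite !mxE linearZ /= mulrA. Qed.

Lemma tprodZr U V (u : U) a (x : V) : tprod u (a *: x) = a *: tprod u x.
Proof. by apply/matrixP => i j; rewrite !mxE linearZ /= mulrCA. Qed.

(** Stated for bare functions, so that after generalizing a subterm such as [delta A one] an
    identity can be checked on pure tensors without recasting both sides as ['Hom]. *)
Lemma eq_linear_tens U V W (f g : tens U V -> W) : linear f -> linear g ->
  (forall u v, f (tprod u v) = g (tprod u v)) -> f =1 g.
Proof.
move=> fL gL fg x.
pose F : {linear tens U V -> W} :=
  HB.pack f (GRing.isLinear.Build K _ _ _ _ fL).
pose G : {linear tens U V -> W} :=
  HB.pack g (GRing.isLinear.Build K _ _ _ _ gL).
have FG : linfun F = linfun G.
  by apply: eq_tens => u v; rewrite !lfunE; apply: fg.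
by have := congr1 (fun h : 'Hom(_, _) => h x) FG; rewrite !lfunE.
Qed.

Definition rcontract V (phi : 'Hom(V, K^o)) U : 'Hom(tens U V, U) :=
  (trunit \o (\1 \ox phi))%VF.

Lemma rcontractE V (phi : 'Hom(V, K^o)) U (u : U) (v : V) :
  rcontract phi U (tprod u v) = phi v *: u.
Proof. by rewrite comp_lfunE tmapE id_lfunE trunitE. Qed.

Lemma rcontract_tswap V (phi : 'Hom(V, K^o)) U (t : tens V U) :
  rcontract phi U (tswap t) = tlunit ((phi \ox \1)%VF t).
Proof.
move: t; apply: eq_linear_tens => [a x y|a x y|v u] /=; rewrite ?linearP //.
by rewrite tswapE rcontractE tmapE id_lfunE tlunitE.
Qed.

Lemma lfun_rcontract V (phi : 'Hom(V, K^o)) U (psi : 'Hom(U, K^o))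
    (t : tens U V) :
  psi (rcontract phi U t) = phi (tlunit ((psi \ox \1)%VF t)).
Proof.
move: t; apply: eq_linear_tens => [a x y|a x y|u v] /=; rewrite ?linearP //.
rewrite rcontractE tmapE id_lfunE tlunitE !linearZ /=.
exact: mulrC.
Qed.

(** For [s = u (x) v] and [t = p (x) q] the sides are [e(up) vq] and [e(up) qv], equal by
    commutativity. With [t] the coproduct of a unit, [S] becomes the antipode. *)
Lemma contract_mul_mul V (m : 'Hom(tens V V, V)) (e : 'Hom(V, K^o))
    (t : tens V V) (S : 'Hom(V, V)) :
  (m \o tswap = m)%VF ->
  (forall a, S a = tlunit (((e \o m) \ox \1)%VF (tassocV (tprod a t)))) ->
  forall s : tens V V,
    tlunit ((e \ox \1)%VF ((m \ox m)%VF (tmidswap (tprod s t)))) =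
    m ((S \ox \1)%VF s).
Proof.
move=> mC SE; apply: eq_linear_tens => [a x y|a x y|u v] /=.
- by rewrite tprodPl !linearP.
- by rewrite !linearP.
rewrite tmapE id_lfunE {}SE; move: t.
apply: eq_linear_tens => [a x y|a x y|p q] /=.
- by rewrite tprodPr !linearP.
- by rewrite tprodPr !linearP tprodPl linearP.
rewrite tmidswapE tassocVE !tmapE !id_lfunE comp_lfunE !tlunitE.
by rewrite tprodZl linearZ /= -{2}mC comp_lfunE tswapE.
Qed.

End TensorMaps.

(** * Functionals multiplicative up to a scalar *)

Section MultiplicativeFunctional.
Variables (C : numClosedFieldType) (H : vectType C) (dot : {dot H for conjC}).

Lemma tdotPl a (x y z : tens H H) :
  tdot dot dot (a *: x + y) z = a * tdot dot dot x z + tdot dot dot y z.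
Proof.
rewrite /tdot mulr_sumr -big_split /=.
apply: eq_bigr => i _; rewrite mulr_sumr -big_split /=.
apply: eq_bigr => j _; rewrite mulr_sumr -big_split /=.
apply: eq_bigr => k _; rewrite mulr_sumr -big_split /=.
by apply: eq_bigr => l _; rewrite !mxE !mulrDl !mulrA.
Qed.

Lemma tdotZl a (x z : tens H H) :
  tdot dot dot (a *: x) z = a * tdot dot dot x z.
Proof.
rewrite /tdot mulr_sumr; apply: eq_bigr => i _.
rewrite mulr_sumr; apply: eq_bigr => j _.
rewrite mulr_sumr; apply: eq_bigr => k _.
by rewrite mulr_sumr; apply: eq_bigr => l _; rewrite !mxE !mulrA.
Qed.

Lemma dot_nondegenerate (u v : H) : (forall x, dot u x = dot v x) -> u = v.
Proof.
move=> uv; apply/eqP; rewrite -subr_eq0 -(dnorm_eq0 dot).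
by rewrite linearBl /= uv subrr.
Qed.

Variables (A : frob_ops H) (hA : is_dagger_SCFA dot A).

Lemma eps_dot u : eps A u = dot u (eta A (1 : C^o)).
Proof. by rewrite -(scfa_eta hA) /cdot rmorph1 mulr1. Qed.

Variables (h : H) (phi : 'Hom(H, C^o)) (phiE : forall u, phi u = dot u h).
Variables (c : C) (c_real : c \is Num.real).

(** Adjointness moves [mu A] across the inner product to [delta A h]; since [c] is real it passes
    through the conjugation. *)
Lemma copyable_multiplicative x y : c *: delta A h = tprod h h ->
  c * phi (mu A (tprod x y)) = phi x * phi y :> C.
Proof.
move=> copy; have phiC u : phi u = (dot h u)^* :> C.
  by rewrite phiE hermC expr0 mul1r.
rewrite !phiC -(scfa_mu hA) -[c in LHS](CrealP c_real) -rmorphM /= -tdotZl.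
by rewrite copy tdotE rmorphM.
Qed.

Hypothesis phiM : forall x y,
  c * phi (mu A (tprod x y)) = phi x * phi y :> C.

Local Notation one := (eta A (1 : C^o)).

Lemma mu1l x : mu A (tprod one x) = x.
Proof.
have := monoid_unitl (frob_monoid (scfa_frobenius hA)).
move/(congr1 (fun f : 'Hom(_, _) => f (@tprod _ C^o H 1 x))).
by rewrite comp_lfunE tmapE id_lfunE tlunitE scale1r.
Qed.

Lemma mu1r x : mu A (tprod x one) = x.
Proof.
have := monoid_unitr (frob_monoid (scfa_frobenius hA)).
move/(congr1 (fun f : 'Hom(_, _) => f (@tprod _ H C^o x 1))).
by rewrite comp_lfunE tmapE id_lfunE trunitE scale1r.
Qed.

Lemma delta_mull x y :
  delta A (mu A (tprod x y)) =
  (\1 \ox mu A)%VF (tassoc (tprod (delta A x) y)).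
Proof.
have := frob_left (scfa_frobenius hA).
move/(congr1 (fun f : 'Hom(_, _) => f (tprod x y))).
by rewrite !comp_lfunE tmapE id_lfunE.
Qed.

Lemma delta_mur x y :
  delta A (mu A (tprod x y)) =
  (mu A \ox \1)%VF (tassocV (tprod x (delta A y))).
Proof.
have := frob_right (scfa_frobenius hA).
move/(congr1 (fun f : 'Hom(_, _) => f (tprod x y))).
by rewrite !comp_lfunE tmapE id_lfunE.
Qed.

Lemma counitl x : tlunit ((eps A \ox \1)%VF (delta A x)) = x.
Proof.
have := comonoid_counitl (frob_comonoid (scfa_frobenius hA)).
move/(congr1 (fun f : 'Hom(_, _) => f x)).
by rewrite !comp_lfunE id_lfunE.
Qed.

Lemma dot_rcontract t x :
  dot (rcontract phi H t) x = tdot dot dot t (tprod x h).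
Proof.
move: t; apply: (@eq_linear_tens _ _ _ C^o) => [a y z||u v].
- by rewrite /= linearP linearPl.
- by move=> a y z; rewrite /= tdotPl.
- by rewrite tdotE rcontractE linearZl_LR /= phiE mulrC.
Qed.

Lemma rcontract_delta_self :
  c *: rcontract phi H (delta A h) = phi h *: h.
Proof.
have dotC y : dot h y = (phi y)^* by rewrite hermC expr0 mul1r phiE.
apply: dot_nondegenerate => x; rewrite !linearZl_LR /= dot_rcontract.
rewrite (scfa_mu hA) !dotC -[c in LHS](CrealP c_real) -rmorphM phiM.
by rewrite rmorphM mulrC /= -[(phi h)^*]dotC -phiE.
Qed.

(** Write [x] as [one] times [x]: by the Frobenius law, [x] multiplies only the second leg of
    [delta A one], and [phiM] splits off [phi x]. *)
Lemma rcontract_delta_unit x :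
  c *: rcontract phi H (delta A x) = phi x *: rcontract phi H (delta A one).
Proof.
rewrite -[x in LHS]mu1l delta_mull.
move: (delta A one); apply: eq_linear_tens => [a y z|a y z|u v] /=.
- by rewrite tprodPl !linearP.
- by rewrite !linearP.
- rewrite tassocE tmapE id_lfunE !rcontractE !scalerA.
  by congr (_ *: _); rewrite phiM mulrC.
Qed.

Lemma rcontract_delta_eta : rcontract phi H (delta A one) = h.
Proof.
(* The general argument cancels [phi h]; if [h = 0] then [phi] vanishes and both sides are zero. *)
have [h0|h0] := eqVneq h 0.
  rewrite h0; move: (delta A one).
  apply: (@eq_linear_tens _ _ _ _ _ (fun=> 0)) => [a y z|a y z|u v] /=.
  - by rewrite linearP.
  - by rewrite scaler0 addr0.
  - by rewrite rcontractE phiE h0 linear0r scale0r.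
have phih0 : phi h != 0 by rewrite phiE dnorm_eq0.
apply: (scalerI phih0); rewrite -rcontract_delta_unit.
exact: rcontract_delta_self.
Qed.

Lemma rcontract_delta x : c *: rcontract phi H (delta A x) = phi x *: h.
Proof. by rewrite rcontract_delta_unit rcontract_delta_eta. Qed.

(** Replace [h] by the contraction of [delta A one]. The other Frobenius law absorbs [x] into the
    first leg, giving [delta A x], and the counit removes that leg. *)
Lemma eps_mu_r x : eps A (mu A (tprod x h)) = phi x.
Proof.
have mu_rcontract t : mu A (tprod x (rcontract phi H t)) =
    rcontract phi H ((mu A \ox \1)%VF (tassocV (tprod x t))).
  move: t; apply: eq_linear_tens => [a y z|a y z|u v] /=.
  - by rewrite linearP tprodPr linearP.
  - by rewrite tprodPr !linearP.
  rewrite tassocVE tmapE id_lfunE !rcontractE.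
  by rewrite tprodZr linearZ.
rewrite -[in LHS]rcontract_delta_eta mu_rcontract -delta_mur mu1r.
by rewrite lfun_rcontract counitl.
Qed.

End MultiplicativeFunctional.

(** * Convolution of the antipode with the identity *)

Lemma antipode_convolution (C : numClosedFieldType) (H : vectType C)
    (dot : {dot H for conjC}) (O O' : frob_ops H) :
  is_dagger_SCFA dot O -> is_dagger_SCFA dot O' ->
  strongly_complementary O O' ->
  ((\dim {:H})%:R *: (mu O \o (antipode O O' \ox \1) \o delta O') =
   eta O \o eps O')%VF.
Proof.
move=> hO hO' []; set c := sqrtC _ => bialg unit counit.
have c_real : c \is Num.real by rewrite ger0_real // sqrtC_ge0 ler0n.
have cc : c * c = (\dim {:H})%:R by rewrite -expr2 sqrtCK.
have eps'M x y : c * eps O' (mu O (tprod x y)) = eps O' x * eps O' y :> C.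
  have := congr1 (fun f : 'Hom(_, _) => f (tprod x y)) counit.
  by rewrite /= scale_lfunE !comp_lfunE tmapE tlunitE.
have eta_copy : c *: delta O' (eta O (1 : C^o)) =
    tprod (eta O (1 : C^o)) (eta O (1 : C^o)).
  have := congr1 (fun f : 'Hom(_, _) => f (1 : C^o)) unit.
  by rewrite /= scale_lfunE !comp_lfunE tlunitVE tmapE.
have epsM x y : c * eps O (mu O' (tprod x y)) = eps O x * eps O y :> C.
  exact: (copyable_multiplicative hO' (eps_dot hO)).
apply/lfunP => x; rewrite scale_lfunE !comp_lfunE.
have S_E a : antipode O O' a =
    tlunit (((eps O \o mu O) \ox \1)%VF
      (tassocV (tprod a (delta O' (eta O' (1 : C^o)))))).
  by rewrite !comp_lfunE trunitVE tmapE id_lfunE comp_lfunE.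
rewrite -(contract_mul_mul (monoid_comm (frob_monoid (scfa_frobenius hO))) S_E).
have bialgx : delta O' (mu O (tprod x (eta O' (1 : C^o)))) =
    c *: (mu O \ox mu O)%VF
      (tmidswap (tprod (delta O' x) (delta O' (eta O' (1 : C^o))))).
  have := congr1 (fun f : 'Hom(_, _) => f (tprod x (eta O' (1 : C^o)))) bialg.
  by rewrite /= scale_lfunE !comp_lfunE tmapE.
have swapE y : tswap (delta O' y) = delta O' y.
  have := comonoid_cocomm (frob_comonoid (scfa_frobenius hO')).
  by move/(congr1 (fun f : 'Hom(_, _) => f y)); rewrite comp_lfunE.
(* Split [D] as [c * c]: one factor serves the bialgebra law, the other the contraction of
   [delta O'] by [eps O]. *)
have -> : forall z : tens H H, (\dim {:H})%:R *: tlunit ((eps O \ox \1)%VF z) =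
    c *: tlunit ((eps O \ox \1)%VF (c *: z)).
  by move=> z; rewrite linearZ /= linearZ /= scalerA cc.
(* Cocommutativity moves the contraction from the first leg to the second. *)
rewrite -bialgx -rcontract_tswap swapE.
rewrite (rcontract_delta hO' (eps_dot hO) c_real epsM).
(* The roles are now exchanged: the algebra is [O] and the functional is [eps O'], represented by
   the unit of [O']. *)
rewrite (eps_mu_r hO (eps_dot hO') c_real eps'M).
by rewrite -[in RHS](mulr1 (eps O' x)) linearZ.
Qed.

Theorem theorem7p2p7 (R : realType) (D : nat) (hD : (1 <= D)%N)
    (H : vectType R[i]) (dot : {dot H for conjC}) (hH : \dim {:H} = D)
    (O O' : frob_ops H)
    (hO : is_dagger_SCFA dot O) (hO' : is_dagger_SCFA dot O')
    (hOO' : strongly_complementary O O') :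
  (D%:R *: (mu O \o (antipode O O' \ox \1) \o delta O') = eta O \o eps O')%VF.
Proof. by rewrite -hH; apply: antipode_convolution hO hO' hOO'. Qed.
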